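(* Let $S=\{s_1,\dots,s_{|S|}\}$ be a finite set, $G=G_S$ the free group on $S$, $X\subset\mathbb{R}$ an interval, and $f_i:X\to X$, $i=1,\dots,|S|$, invertible functions generating the multi-dimensional-time dynamical system (MDTDS) $(t,x)\mapsto D_t(x)$. A point $x\in X$ is a fixed point of the MDTDS if and only if $x$ is a fixed point of $f_i$ for every $i=1,\dots,|S|$.
   Context: Every $t\in G$ is written $t=s_{i_1}^{\varepsilon_1}\cdots s_{i_n}^{\varepsilon_n}$ with $\varepsilon_j\in\mathbb{Z}$, and for $x\in X$ one sets $D_t(x)=f_{i_n}^{\varepsilon_n}(f_{i_{n-1}}^{\varepsilon_{n-1}}(\cdots f_{i_1}^{\varepsilon_1}(x)\cdots))$, where $f^m$ denotes the $m$-fold iterate (iterates of the inverse function for $m<0$, identity for $m=0$). For the identity $e\in G$, $D_e(x)=x$, and $D_{t_2}(D_{t_1}(x))=D_{t_1t_2}(x)$. A point $x\in X$ is a fixed point of the MDTDS if $D_t(x)=x$ for all $t\in G$. *)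

(* Defs.v *)
From HB Require Import structures.
From mathcomp Require Import all_boot all_order all_algebra.
From mathcomp Require Import all_classical all_reals all_analysis.

Set Implicit Arguments.
Unset Strict Implicit.
Unset Printing Implicit Defensive.

Import GRing.Theory.

Local Open Scope ring_scope.

(* The free group on [S]: an element is represented by its normal form
   s_1^e_1 ... s_n^e_n, stored as the sequence of the (s_j, e_j), with
   e_j <> 0 and s_j <> s_(j+1). *)

Definition reduced (S : eqType) (w : seq (S * int)) : bool :=
  all (fun p => p.2 != 0) w && sorted (fun p q => p.1 != q.1) w.

(* Left multiplication of a normal form by s^e. *)
Definition syl_cons (S : eqType) (p : S * int) (w : seq (S * int)) :=
  if p.2 == 0 then w
  else if w is q :: w' then
    if p.1 == q.1 then
      if p.2 + q.2 == 0 then w' else (p.1, p.2 + q.2) :: w'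
    else p :: w
  else [:: p].

Definition reduce (S : eqType) (w : seq (S * int)) := foldr (@syl_cons S) [::] w.

Section Reduce.
Variable S : eqType.
Implicit Types (p q : S * int) (u v w : seq (S * int)).

Lemma reduced_behead p w : reduced (p :: w) -> reduced w.
Proof. by rewrite /reduced /= => /andP[/andP[_ ->]] /path_sorted ->. Qed.

Lemma reduced_cons2 p q w :
  reduced [:: p, q & w] = [&& p.2 != 0, p.1 != q.1 & reduced (q :: w)].
Proof. by rewrite /reduced /=; do !case: (_ != _) => //=; rewrite ?andbF. Qed.

Lemma syl_cons_reduced p w : reduced w -> reduced (syl_cons p w).
Proof.
move=> rw; rewrite /syl_cons; case: ifPn => // p0.
case: w rw => [|q w] rw; first by rewrite /reduced /= p0.
case: ifPn => [/eqP pq|pq]; last by rewrite reduced_cons2 p0 pq.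
case: ifPn => [_|s0]; first exact: reduced_behead rw.
case: w rw => [|r w] rw; first by rewrite /reduced /= s0.
by move: rw; rewrite !reduced_cons2 /= s0 pq => /and3P[_ -> ->].
Qed.

Lemma reduce_reduced w : reduced (reduce w).
Proof. by elim: w => //= p w; apply: syl_cons_reduced. Qed.

Lemma syl_cons_id p w : reduced (p :: w) -> syl_cons p w = p :: w.
Proof.
rewrite /syl_cons; case: w => [|q w].
  by rewrite /reduced /= !andbT => /negPf ->.
by rewrite reduced_cons2 => /and3P[/negPf -> /negPf ->].
Qed.

Lemma reduce_id w : reduced w -> reduce w = w.
Proof.
elim: w => //= p w IH rw.
by rewrite IH ?syl_cons_id//; apply: reduced_behead rw.
Qed.

Lemma syl_consD s (a b : int) w : reduced w ->
  syl_cons (s, a) (syl_cons (s, b) w) = syl_cons (s, a + b) w.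
Proof.
move=> rw; rewrite {2}/syl_cons /=.
have [->|b0] := eqVneq b 0; first by rewrite addr0.
case: w rw => [|q w] rw /=.
  by rewrite /syl_cons /= eqxx; case: eqP => // ->; rewrite add0r (negPf b0).
have [sq|sq] := eqVneq s q.1; last first.
  rewrite /syl_cons /= (negPf sq) eqxx.
  by case: eqP => // ->; rewrite add0r (negPf b0).
have Eq c : c = q.2 -> (s, c) = q by move=> ->; rewrite sq; case: (q).
have q0 : q.2 != 0 by case/andP: rw => /andP[].
have [b1|b1] := eqVneq (b + q.2) 0.
  have bq : b = - q.2 by apply/eqP; rewrite -addr_eq0 b1.
  have [->|a0] := eqVneq a 0.
    by rewrite add0r /syl_cons /= (negPf b0) sq eqxx b1 eqxx.
  rewrite [RHS]/syl_cons /= sq eqxx -addrA b1 addr0 (negPf a0) -sq.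
  rewrite syl_cons_id; last first.
    case: w rw => [|r w] rw; first by rewrite /reduced /= a0.
    by move: rw; rewrite !reduced_cons2 /= a0 -sq => /and3P[_ -> ->].
  have [ab|_] := eqVneq (a + b) 0; last by [].
  by congr (_ :: _); apply: Eq; rewrite -[a]addr0 -b1 addrA ab add0r.
rewrite /syl_cons /= sq eqxx addrA.
have [->|a0] := eqVneq a 0; last first.
  case: (eqVneq (a + b) 0) => [->|//]; rewrite add0r (negPf q0).
  by congr (_ :: _); rewrite -sq; apply: Eq.
by rewrite !add0r (negPf b0) (negPf b1).
Qed.

Lemma foldr_reduced u w : reduced w -> reduced (foldr (@syl_cons S) w u).
Proof. by move=> rw; elim: u => //= p u; apply: syl_cons_reduced. Qed.

Lemma foldr_syl_cons p v w : reduced w ->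
  foldr (@syl_cons S) w (syl_cons p v) = syl_cons p (foldr (@syl_cons S) w v).
Proof.
case: p => s a rw; rewrite [syl_cons _ v]/syl_cons /=.
have [->|a0] := eqVneq a 0; first by rewrite /syl_cons eqxx.
case: v => [|[t b] v] //=; have [<-|//] := eqVneq s t.
rewrite syl_consD ?foldr_reduced//; have [->|//] := eqVneq (a + b) 0.
by rewrite /syl_cons eqxx.
Qed.

Lemma foldr_reduce u w : reduced w ->
  foldr (@syl_cons S) w (reduce u) = foldr (@syl_cons S) w u.
Proof. by move=> rw; elim: u => //= p u IH; rewrite foldr_syl_cons ?IH. Qed.

Lemma reduce_cat u v : reduce (u ++ v) = foldr (@syl_cons S) (reduce v) u.
Proof. exact: foldr_cat. Qed.

Lemma reduce_catl u v : reduce (reduce u ++ v) = reduce (u ++ v).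
Proof. by rewrite !reduce_cat foldr_reduce ?reduce_reduced. Qed.

Lemma reduce_catr u v : reduce (u ++ reduce v) = reduce (u ++ v).
Proof. by rewrite !reduce_cat (reduce_id (reduce_reduced _)). Qed.

Definition inv_word w := rev [seq (p.1, - p.2) | p <- w].

Lemma inv_wordK : involutive inv_word.
Proof.
move=> w; rewrite /inv_word map_rev revK -map_comp -[RHS]map_id.
by apply: eq_map => -[s e] /=; rewrite opprK.
Qed.

Lemma reduce_invr w : reduce (w ++ inv_word w) = [::].
Proof.
elim: w => //= -[s e] w IH; rewrite /inv_word /= rev_cons -cats1 catA.
rewrite -/(inv_word w) -reduce_catl IH /= {2}/syl_cons /= oppr_eq0.
have [->|e0] := eqVneq e 0; first by rewrite /syl_cons eqxx.
by rewrite /syl_cons /= (negPf e0) eqxx subrr eqxx.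
Qed.

End Reduce.

Record free_group (S : choiceType) :=
  FreeGroup { fg_word :> seq (S * int); fg_wordP : reduced fg_word }.

HB.instance Definition _ (S : choiceType) := [isSub for @fg_word S].
HB.instance Definition _ (S : choiceType) := [Choice of free_group S by <:].

Section FreeGroupGroup.
Variable S : choiceType.
Implicit Types t : free_group S.

Definition fg_of (w : seq (S * int)) : free_group S :=
  FreeGroup (reduce_reduced w).

Definition fg_one : free_group S := fg_of [::].
Definition fg_mul t1 t2 : free_group S := fg_of (t1 ++ t2).
Definition fg_inv t : free_group S := fg_of (inv_word t).

Lemma fg_ofK t : fg_of t = t.
Proof. by apply: val_inj; rewrite /= reduce_id ?fg_wordP. Qed.

Lemma fg_mulA : associative fg_mul.
Proof.
by move=> a b c; apply: val_inj; rewrite /= reduce_catl reduce_catr catA.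
Qed.

Lemma fg_mul1 : left_id fg_one fg_mul.
Proof. exact: fg_ofK. Qed.

Lemma fg_mulr1 : right_id fg_one fg_mul.
Proof. by move=> t; rewrite /fg_mul cats0 fg_ofK. Qed.

Lemma fg_mulV : left_inverse fg_one fg_inv fg_mul.
Proof.
move=> t; apply: val_inj; rewrite /= reduce_catl.
by rewrite -{2}[fg_word t]inv_wordK reduce_invr.
Qed.

Lemma fg_mulrV : right_inverse fg_one fg_inv fg_mul.
Proof. by move=> t; apply: val_inj; rewrite /= reduce_catr reduce_invr. Qed.

HB.instance Definition _ :=
  isGroup.Build (free_group S) fg_mulA fg_mul1 fg_mulr1 fg_mulV fg_mulrV.

Definition fg_gen (s : S) : free_group S := fg_of [:: (s, 1)].

End FreeGroupGroup.

Definition zexpg (G : groupType) (x : G) (m : int) : G :=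
  match m with Posz n => (x ^+ n)%g | Negz n => (x ^- n.+1)%g end.

Section ZexpgTheory.
Variable G : groupType.
Implicit Types x : G.

Lemma zexpgS x m : zexpg x (m + 1) = (x * zexpg x m)%g.
Proof.
case: m => [n|[|n]] /=; first by rewrite addn1 expgS.
  by rewrite expg1 mulgV.
by rewrite subn1 /= (expgSr x n.+1) invgM mulVKg.
Qed.

Lemma zexpgD x m n : zexpg x (m + n) = (zexpg x m * zexpg x n)%g.
Proof.
elim/int_rect: m => [|m IH|m IH]; first by rewrite add0r /= mul1g.
  by rewrite -addn1 PoszD addrAC !zexpgS IH mulgA.
apply: (mulgI x); rewrite mulgA -!zexpgS addrAC.
by rewrite -addn1 PoszD opprD addrNK.
Qed.

End ZexpgTheory.

Section FreeGroupTheory.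
Variable S : choiceType.

Lemma fg_ofM (u v : seq (S * int)) : fg_of (u ++ v) = (fg_of u * fg_of v)%g.
Proof. by apply: val_inj; rewrite /= reduce_catl reduce_catr. Qed.

Lemma fg_gen_zexp (s : S) (m : int) : zexpg (fg_gen s) m = fg_of [:: (s, m)].
Proof.
have E a b : fg_of [:: (s, a + b)] = (fg_of [:: (s, a)] * fg_of [:: (s, b)])%g.
  by rewrite -fg_ofM; apply: val_inj; rewrite /= syl_consD.
have E0 : fg_of [:: (s, 0 : int)] = 1%g by apply: val_inj.
elim/int_rect: m => [|m IH|m IH]; first by rewrite E0.
  by rewrite -addn1 PoszD zexpgS IH addrC E.
apply: (mulgI (fg_gen s)); rewrite -zexpgS -E -addn1 PoszD opprD addrNK.
by rewrite addrCA subrr addr0.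
Qed.

(* Every word in the generators denotes the element obtained by reducing it. *)
Lemma fg_ofE (w : seq (S * int)) :
  fg_of w = (\prod_(p <- w) zexpg (fg_gen p.1) p.2)%g.
Proof.
elim: w => [|[s e] w IH]; first by rewrite big_nil.
by rewrite big_cons -IH fg_gen_zexp -fg_ofM.
Qed.

Lemma fg_expand (t : free_group S) :
  t = (\prod_(p <- fg_word t) zexpg (fg_gen p.1) p.2)%g.
Proof. by rewrite -fg_ofE fg_ofK. Qed.

Lemma free_group_universal (H : groupType) (phi : S -> H) :
  exists! h : free_group S -> H,
    {morph h : t1 t2 / (t1 * t2)%g} /\ forall s, h (fg_gen s) = phi s.
Proof.
pose F (w : seq (S * int)) := (\prod_(p <- w) zexpg (phi p.1) p.2)%g.
have Fcons p w : F (syl_cons p w) = (zexpg (phi p.1) p.2 * F w)%g.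
  rewrite /syl_cons; case: p => s a /=.
  have [->|_] := eqVneq a 0; first by rewrite /= mul1g.
  case: w => [|[r b] w] /=; first by rewrite /F !big_cons.
  have [<-|_] := eqVneq s r; last by rewrite /F !big_cons.
  have [ab|_] := eqVneq (a + b) 0; rewrite /F !big_cons /= mulgA -zexpgD //.
  by rewrite ab mul1g.
have Fred w : F (reduce w) = F w.
  by elim: w => //= p w IH; rewrite Fcons IH /F big_cons.
exists (fun t => F t); split.
  split=> [t1 t2|s]; first by rewrite /= Fred /F big_cat.
  by rewrite [LHS]Fred /F big_seq1 /= expg1.
move=> h [hM hs]; apply/funext => t.
have h1 : h 1%g = 1%g by apply: (mulgI (h 1%g)); rewrite -hM !mulg1.
have hz x m : h (zexpg x m) = zexpg (h x) m.
  elim/int_rect: m => [//|m IH|m IH]; first by rewrite -addn1 PoszD !zexpgS hM IH.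
  apply: (mulgI (h x)); rewrite -hM -!zexpgS.
  by rewrite -addn1 PoszD opprD addrNK.
rewrite [in RHS](fg_expand t) /F; elim: (fg_word t) => [|p w IH].
  by rewrite !big_nil h1.
by rewrite !big_cons hM hz hs IH.
Qed.

End FreeGroupTheory.

(* The inverse of a bijection; the default value [y] is irrelevant then. *)
Definition inv_fun (T : choiceType) (g : T -> T) (y : T) : T :=
  xget y [set x | g x = y]%classic.

Definition iterz (T : choiceType) (g : T -> T) (m : int) : T -> T :=
  match m with Posz n => iter n g | Negz n => iter n.+1 (inv_fun g) end.

(* The syllable on the left acts first. *)
Definition eval_word (T : choiceType) (S : Type) (f : S -> T -> T)
    (w : seq (S * int)) (x : T) : T :=
  foldl (fun y p => iterz (f p.1) p.2 y) x w.

Definition mdtds (T S : choiceType) (f : S -> T -> T) (t : free_group S) (x : T) : T :=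
  eval_word f t x.

Definition mdtds_fixed_point (T S : choiceType) (f : S -> T -> T) (x : T) : Prop :=
  forall t : free_group S, mdtds f t x = x.

Section MdtdsTheory.
Variables T S : choiceType.

Lemma inv_funK (g : T -> T) : bijective g -> cancel g (inv_fun g).
Proof.
case=> h gK hK x; apply: (can_inj gK).
by rewrite /inv_fun; case: xgetP => [y _ /= -> //|/(_ x)] /(_ erefl).
Qed.

Lemma inv_funKV (g : T -> T) : bijective g -> cancel (inv_fun g) g.
Proof. by move=> bg; apply/(bij_can_sym bg); apply: inv_funK. Qed.

Lemma iterzS (g : T -> T) : bijective g ->
  forall m x, iterz g (m + 1) x = g (iterz g m x).
Proof.
move=> bg [n|[|n]] x /=; first by rewrite addn1.
  by rewrite inv_funKV.
by rewrite subn1 inv_funKV.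
Qed.

Lemma iterzD (g : T -> T) : bijective g ->
  forall m n x, iterz g (m + n) x = iterz g m (iterz g n x).
Proof.
move=> bg m n x; elim/int_rect: m => [|m IH|m IH]; first by rewrite add0r.
  by rewrite -addn1 PoszD addrAC !iterzS// IH.
apply: (bij_inj bg); rewrite -!iterzS// addrAC.
by rewrite -addn1 PoszD opprD addrNK.
Qed.

Variable f : S -> T -> T.
Hypothesis f_bij : forall s, bijective (f s).

Lemma eval_word_reduce w x : eval_word f (reduce w) x = eval_word f w x.
Proof.
elim: w x => //= -[s a] w IH x; rewrite -IH /= /syl_cons /=.
have [->//|_] := eqVneq a 0.
case: (reduce w) => [|[r b] v] //=; have [<-|//] := eqVneq s r.
by have [ab|_] := eqVneq (a + b) 0; rewrite /= -iterzD// [b + a]addrC // ab.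
Qed.

(* [mdtds f t] can be computed from any expression of [t]. *)
Lemma mdtdsE (w : seq (S * int)) (x : T) :
  mdtds f (\prod_(p <- w) zexpg (fg_gen p.1) p.2)%g x = eval_word f w x.
Proof. by rewrite -fg_ofE; apply: eval_word_reduce. Qed.

Lemma mdtds1 x : mdtds f 1%g x = x.
Proof. by []. Qed.

Lemma mdtdsM t1 t2 x : mdtds f (t1 * t2)%g x = mdtds f t2 (mdtds f t1 x).
Proof. by rewrite /mdtds /= eval_word_reduce /eval_word foldl_cat. Qed.

End MdtdsTheory.

(* Main.v *)
Require Import Defs.
From mathcomp Require Import all_boot all_order all_algebra.
From mathcomp Require Import all_classical all_reals all_analysis.

(** A point fixed by a bijection is fixed by its inverse, hence by all integer iterates; so a common
    fixed point of the [f i] is left in place by each syllable of a word in turn. Conversely, a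
    generator acts as [f i] itself. *)

Lemma iterz_fixed (T : choiceType) (g : T -> T) (m : int) (x : T) :
  bijective g -> g x = x -> iterz g m x = x.
Proof.
move=> bg gx; have Vgx : Defs.inv_fun g x = x by rewrite -{1}gx Defs.inv_funK.
by case: m => n /=; rewrite iter_fix.
Qed.

Lemma eval_word_fixed (T : choiceType) (S : Type) (f : S -> T -> T)
    (w : seq (S * int)) (x : T) :
  (forall s, bijective (f s)) -> (forall s, f s x = x) -> eval_word f w x = x.
Proof.
by move=> f_bij fx; elim: w => //= -[s m] w IH; rewrite iterz_fixed.
Qed.

Theorem proposition4p1 (R : realType) (S : finType) (X : set R)
    (X_itv : is_interval X) (f : S -> X -> X)
    (f_bij : forall i : S, bijective (f i)) (x : X) :
  mdtds_fixed_point f x <-> forall i : S, f i x = x.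
Proof.
(* The normal form of [fg_gen i] is the single syllable [(i, 1)], so its action on [x] computes to
   [f i x]. *)
split=> [fix_x i|fx t]; first exact: (fix_x (fg_gen i)).
exact: eval_word_fixed.
Qed.
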